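(* Let $X$ be a vector space over the field $\mathbb{K}=\mathbb{R}$ or $\mathbb{C}$. Let $\mathcal{F}$ be the set of fuzzy norms on $X$, and let $\mathcal{A}$ be the set of quasiconcave functions $f:X\to[0,1]$ such that (A1) $f(0)=1$ and, if $x\in X$ satisfies $f(tx)=1$ for every $t\in\mathbb{R}$, then $x=0$; (A2) $\lim_{t\to 0}f(tx)=1$ for every $x\in X$ (with $t$ real); (A3) $f(\lambda x)=f(|\lambda|x)$ for all $\lambda\in\mathbb{K}$ and $x\in X$. Then the map $\mathcal{A}\to\mathcal{F}$, $f\mapsto N_f$, where for $x\in X$ and $t\in[0,\infty)$ $$N_f(x,t)=\begin{cases} f\left(\frac{x}{t}\right) & \text{if } t\neq 0,\\ 0 & \text{if } t=0,\end{cases}$$ is well defined (i.e. $N_f\in\mathcal{F}$ for every $f\in\mathcal{A}$) and bijective.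
   Context: A function $f:X\to\mathbb{R}$ on a real or complex vector space is quasiconcave if $f(\lambda x+(1-\lambda)y)\geq\min\{f(x),f(y)\}$ for all $x,y\in X$ and all real $0<\lambda<1$. A fuzzy norm on a vector space $X$ over $\mathbb{K}$ is a function $N:X\times[0,\infty)\to[0,1]$ satisfying: (N1) $N(x,0)=0$ for all $x\in X$; (N2) [$N(x,t)=1$ for all $t>0$] if and only if $x=0$; (N3) $N(\lambda x,t)=N\left(x,\frac{t}{|\lambda|}\right)$ for all $t\geq 0$, $x\in X$ and $0\neq\lambda\in\mathbb{K}$; (N4) $N(x+y,t+s)\geq\min\{N(x,t),N(y,s)\}$ for all $x,y\in X$ and $t,s\geq 0$; (N5) for each $x\in X$, $\lim_{t\to\infty}N(x,t)=1$. *)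

(* Defs.v *)
From mathcomp Require Import all_boot all_order all_algebra.
From mathcomp Require Import all_classical all_reals all_analysis.
From mathcomp Require Import complex.

Set Implicit Arguments.
Unset Strict Implicit.
Unset Printing Implicit Defensive.

Import Order.TTheory GRing.Theory Num.Theory.
Import numFieldNormedType.Exports.

Local Open Scope classical_set_scope.
Local Open Scope ring_scope.

Variant scalar_kind := RealScalars | ComplexScalars.

Definition scalar_field (R : realType) (k : scalar_kind) : numFieldType :=
  match k with
  | RealScalars => R
  | ComplexScalars => R[i]
  end.

Definition of_real (R : realType) (k : scalar_kind) : R -> scalar_field R k :=
  match k return R -> scalar_field R k with
  | RealScalars => fun t => t
  | ComplexScalars => fun t => real_complex R t
  end.

Lemma Re_norm_ge0 (R : realType) (z : R[i]) : 0 <= complex.Re `|z|.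
Proof. by rewrite normc_def /= sqrtr_ge0. Qed.

(* The norm of [R[i]] takes its values in [R[i]] itself, as complex numbers
   with zero imaginary part; [abs_real] is the real number |z|. *)
Definition abs_real (R : realType) (k : scalar_kind) :
    scalar_field R k -> {nonneg R} :=
  match k return scalar_field R k -> {nonneg R} with
  | RealScalars => fun z : R => NngNum (normr_ge0 z)
  | ComplexScalars => fun z : R[i] => NngNum (Re_norm_ge0 z)
  end.

(* The filter "t tends to infinity" on [0, +oo[. *)
Definition nonneg_pinfty (R : realType) : set_system {nonneg R} :=
  filter_from setT (fun M : R => [set t : {nonneg R} | M < t%:num]).

Arguments nonneg_pinfty : clear implicits.

Section FuzzyNorms.
Context (R : realType) (k : scalar_kind) (X : lmodType (scalar_field R k)).

Definition quasiconcave (f : X -> R) : Prop :=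
  forall (x y : X) (l : R), 0 < l < 1 ->
    Num.min (f x) (f y) <= f (of_real k l *: x + of_real k (1 - l) *: y).

Record is_fuzzy_norm (N : X -> {nonneg R} -> R) : Prop := IsFuzzyNorm {
  fuzzy_norm_range : forall x t, 0 <= N x t <= 1;
  fuzzy_norm_N1 : forall x, N x 0%:nng = 0;
  fuzzy_norm_N2 : forall x,
    (forall t : {nonneg R}, 0 < t%:num -> N x t = 1) <-> x = 0;
  fuzzy_norm_N3 : forall (t : {nonneg R}) (x : X) (l : scalar_field R k),
    l != 0 ->
    N (l *: x) t = N x (t%:num / (abs_real l)%:num)%:nng;
  fuzzy_norm_N4 : forall (x y : X) (t s : {nonneg R}),
    Num.min (N x t) (N y s) <= N (x + y) (t%:num + s%:num)%:nng;
  fuzzy_norm_N5 : forall x : X, N x t @[t --> nonneg_pinfty R] --> (1 : R)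
}.

Record is_classA (f : X -> R) : Prop := IsClassA {
  classA_range : forall x, 0 <= f x <= 1;
  classA_quasiconcave : quasiconcave f;
  classA_A1 : f 0 = 1 /\
    (forall x : X, (forall t : R, f (of_real k t *: x) = 1) -> x = 0);
  classA_A2 : forall x : X, f (of_real k t *: x) @[t --> (0 : R)^'] --> (1 : R);
  classA_A3 : forall (l : scalar_field R k) (x : X),
    f (l *: x) = f (of_real k (abs_real l)%:num *: x)
}.

Definition fuzzy_norms : set (X -> {nonneg R} -> R) :=
  [set N | is_fuzzy_norm N].

Definition classA : set (X -> R) := [set f | is_classA f].

Definition fuzzy_norm_of (f : X -> R) (x : X) (t : {nonneg R}) : R :=
  if t%:num != 0 then f (of_real k (t%:num)^-1 *: x) else 0.

End FuzzyNorms.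

Arguments fuzzy_norms {R k} X.
Arguments classA {R k} X.

(* Main.v *)
Require Import Defs.
From mathcomp Require Import all_boot all_order all_algebra.
From mathcomp Require Import all_classical all_reals all_analysis.
From mathcomp Require Import complex.

(** The assignment [f |-> N_f] is inverted by restricting a fuzzy norm to time
    one, [N |-> N(., 1)]: homogeneity (N3) gives [N (x, t) = N (x / t, 1)] for
    [t > 0], while (N1) fixes the value at [t = 0].  Under this dictionary each
    axiom on one side is a rescaling of an axiom on the other.

    - (N4) is quasiconcavity: [(x + y) / (t + s)] is the convex combination of
      [x / t] and [y / s] with weights [t / (t + s)] and [s / (t + s)];
      conversely the weights [l] and [1 - l] of a convex combination, used as
      times, add up to one ([fuzzy_norm_of_triangle], [quasiconcave_time_one]).
    - (N5) is (A2) because [t |-> 1 / t] exchanges the filters at infinity and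
      at zero ([cvg_inv_nonneg_pinfty], [cvg_inv_norm_dnbhs0]).
    - (N2) is (A1) and (N3) is (A3), once one knows that a function in the
      class only sees the modulus of a scalar.

    Both scalar fields are treated at once: the case distinction is confined to
    a few facts on the embedding of the reals and on the real modulus. *)

Set Implicit Arguments.
Unset Strict Implicit.
Unset Printing Implicit Defensive.

Import Order.TTheory GRing.Theory Num.Theory.
Import numFieldNormedType.Exports.

Local Open Scope classical_set_scope.
Local Open Scope ring_scope.

(** * Real scalars and the real modulus *)

Section Scalars.
Context {R : realType} {k : scalar_kind}.
Implicit Types (r s : R) (l m : scalar_field R k).

Lemma of_real0 : of_real k (0 : R) = 0.
Proof. by case: k. Qed.

Lemma of_real1 : of_real k (1 : R) = 1.
Proof. by case: k. Qed.

Lemma of_realM r s : of_real k (r * s) = of_real k r * of_real k s.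
Proof. by case: k => //=; rewrite rmorphM. Qed.

Lemma of_real_eq0 r : (of_real k r == 0) = (r == 0).
Proof. by case: k => //=; rewrite fmorph_eq0. Qed.

Lemma abs_real_of_real r : (abs_real (of_real k r))%:num = `|r|.
Proof. by case: k => //=; rewrite expr0n addr0 sqrtr_sqr. Qed.

Lemma abs_realM l m :
  (abs_real (l * m))%:num = (abs_real l)%:num * (abs_real m)%:num.
Proof.
case: k l m => /= l m; first by rewrite normrM.
exact: Normc.normcM.
Qed.

Lemma abs_real0 : (abs_real (0 : scalar_field R k))%:num = 0.
Proof. by rewrite -of_real0 abs_real_of_real normr0. Qed.

Lemma abs_real_eq0 l : ((abs_real l)%:num == 0) = (l == 0).
Proof.
apply/eqP/eqP => [|->]; last exact: abs_real0.
case: k l => /= l; first exact: normr0_eq0.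
exact: Normc.eq0_normc.
Qed.

End Scalars.

(** * Inversion exchanges the filters at infinity and at zero *)

#[local] Instance nonneg_pinfty_filter (R : realType) : Filter (nonneg_pinfty R).
Proof.
apply: filter_from_filter; first by exists 0.
move=> M M' _ _; exists (Num.max M M') => // t /=.
by rewrite gt_max => /andP[].
Qed.

Section Filters.
Context {R : realType}.

Lemma near_nonneg_pinfty_gt0 : \forall t \near nonneg_pinfty R, 0 < t%:num.
Proof. by exists 0. Qed.

Lemma cvg_inv_nonneg_pinfty :
  (t%:num)^-1 @[t --> nonneg_pinfty R] --> (0 : R)^'.
Proof.
move=> A /nbhs_ballP[e /= e0 eA]; exists e^-1 => // t /= et.
have t0 : 0 < t%:num by rewrite (lt_trans _ et)// invr_gt0.
apply: eA; last by rewrite invr_eq0 gt_eqF.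
rewrite /ball/= sub0r normrN gtr0_norm ?invr_gt0//.
by rewrite -(invrK e) ltf_pV2 ?posrE ?invr_gt0.
Qed.

Lemma cvg_inv_norm_dnbhs0 :
  (`|t|^-1)%:nng @[t --> (0 : R)^'] --> nonneg_pinfty R.
Proof.
move=> A [M _ MA].
(* [|M| + 1] rather than [M], which may be zero or negative *)
have M0 : 0 < `|M| + 1 by rewrite ltr_wpDl.
apply/nbhs_ballP; exists (`|M| + 1)^-1; first by rewrite /= invr_gt0.
move=> t; rewrite /ball/= sub0r normrN => tM t0; apply: MA => /=.
apply: le_lt_trans (ler_norm M) _; apply: (@lt_trans _ _ (`|M| + 1)).
  by rewrite ltrDl.
by rewrite -(invrK (_ + 1)) ltf_pV2 ?posrE ?invr_gt0 ?normr_gt0.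
Qed.

End Filters.

(** * From the class of quasiconcave functions to fuzzy norms *)

Section FuzzyNormOfClassA.
Context {R : realType} {k : scalar_kind} {X : lmodType (scalar_field R k)}.
Variable f : X -> R.
Hypothesis fA : is_classA f.

Lemma fuzzy_norm_of0 (x : X) (t : {nonneg R}) :
  t%:num = 0 -> fuzzy_norm_of f x t = 0.
Proof. by rewrite /fuzzy_norm_of => ->; rewrite eqxx. Qed.

Lemma fuzzy_norm_of_gt0 (x : X) (t : {nonneg R}) :
  0 < t%:num -> fuzzy_norm_of f x t = f (of_real k (t%:num)^-1 *: x).
Proof. by rewrite /fuzzy_norm_of => t0; rewrite gt_eqF. Qed.

Lemma classA_abs (l m : scalar_field R k) (x : X) :
  (abs_real l)%:num = (abs_real m)%:num -> f (l *: x) = f (m *: x).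
Proof.
by move=> lm; rewrite (classA_A3 fA) lm -(classA_A3 fA).
Qed.

Lemma fuzzy_norm_of_range (x : X) (t : {nonneg R}) :
  0 <= fuzzy_norm_of f x t <= 1.
Proof.
rewrite /fuzzy_norm_of; case: ifP => _; first exact: (classA_range fA).
by rewrite lexx ler01.
Qed.

Lemma fuzzy_norm_of_eq1 (x : X) :
  (forall t : {nonneg R}, 0 < t%:num -> fuzzy_norm_of f x t = 1) <-> x = 0.
Proof.
have [f0 f1] := classA_A1 fA; split=> [Nx1|-> t t0]; last first.
  by rewrite fuzzy_norm_of_gt0// scaler0.
apply: f1 => t; have [->|t0] := eqVneq t 0; first by rewrite of_real0 scale0r.
have t'0 : 0 < `|t|^-1 by rewrite invr_gt0 normr_gt0.
rewrite -[RHS](Nx1 (`|t|^-1)%:nng)// fuzzy_norm_of_gt0//= invrK.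
by apply: classA_abs; rewrite !abs_real_of_real normr_id.
Qed.

Lemma fuzzy_norm_of_scale (t : {nonneg R}) (x : X) (l : scalar_field R k) :
  l != 0 ->
  fuzzy_norm_of f (l *: x) t
  = fuzzy_norm_of f x (t%:num / (abs_real l)%:num)%:nng.
Proof.
rewrite -abs_real_eq0 => l0; rewrite /fuzzy_norm_of /= mulf_eq0 invr_eq0.
rewrite (negbTE l0) orbF; case: ifP => // _.
rewrite scalerA; apply: classA_abs.
rewrite abs_realM !abs_real_of_real invfM invrK normrM.
by rewrite [X in _ = _ * X]ger0_norm.
Qed.

(** [(x + y) / (t + s)] is a convex combination of [x / t] and [y / s]. *)
Lemma fuzzy_norm_of_triangle (x y : X) (t s : {nonneg R}) :
  Num.min (fuzzy_norm_of f x t) (fuzzy_norm_of f y s)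
    <= fuzzy_norm_of f (x + y) (t%:num + s%:num)%:nng.
Proof.
have N0 z u : 0 <= fuzzy_norm_of f z u by case/andP: (fuzzy_norm_of_range z u).
have [t0|t0] := eqVneq t%:num 0.
  by rewrite (fuzzy_norm_of0 x t0) ge_min N0.
have [s0|s0] := eqVneq s%:num 0.
  by rewrite (fuzzy_norm_of0 y s0) ge_min N0 orbT.
have {}t0 : 0 < t%:num by rewrite lt_def t0 ge0.
have {}s0 : 0 < s%:num by rewrite lt_def s0 ge0.
have ts0 : 0 < t%:num + s%:num by rewrite addr_gt0.
rewrite !fuzzy_norm_of_gt0//=.
set l := t%:num / (t%:num + s%:num).
have l01 : 0 < l < 1 by rewrite divr_gt0//= ltr_pdivrMr// mul1r ltrDl.
have lt : l * (t%:num)^-1 = (t%:num + s%:num)^-1.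
  by rewrite /l mulrAC divff ?mul1r// gt_eqF.
have ls : (1 - l) * (s%:num)^-1 = (t%:num + s%:num)^-1.
  rewrite /l -{1}(@divff _ (t%:num + s%:num)) ?gt_eqF// -mulrBl addrAC subrr.
  by rewrite add0r mulrAC divff ?mul1r// gt_eqF.
have := classA_quasiconcave fA
  (of_real k (t%:num)^-1 *: x) (of_real k (s%:num)^-1 *: y) l01.
by rewrite !scalerA -!of_realM lt ls -scalerDr.
Qed.

Lemma fuzzy_norm_of_cvg (x : X) :
  fuzzy_norm_of f x t @[t --> nonneg_pinfty R] --> (1 : R).
Proof.
apply: cvg_trans (cvg_comp _ _ cvg_inv_nonneg_pinfty (classA_A2 fA x)).
apply: near_eq_cvg; apply: filterS near_nonneg_pinfty_gt0 => t t0.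
by rewrite /= fuzzy_norm_of_gt0.
Qed.

Lemma fuzzy_norm_of_is_fuzzy_norm : is_fuzzy_norm (fuzzy_norm_of f).
Proof.
split.
- exact: fuzzy_norm_of_range.
- by move=> x; exact: fuzzy_norm_of0.
- exact: fuzzy_norm_of_eq1.
- exact: fuzzy_norm_of_scale.
- exact: fuzzy_norm_of_triangle.
- exact: fuzzy_norm_of_cvg.
Qed.

End FuzzyNormOfClassA.

(** * From fuzzy norms back to quasiconcave functions *)

Section TimeOne.
Context {R : realType} {k : scalar_kind} {X : lmodType (scalar_field R k)}.

Definition time_one (N : X -> {nonneg R} -> R) (x : X) : R := N x 1%:nng.

Lemma fuzzy_norm_ofK (f : X -> R) : time_one (fuzzy_norm_of f) = f.
Proof.
apply/funext => x.
by rewrite /time_one fuzzy_norm_of_gt0//= invr1 of_real1 scale1r.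
Qed.

Variable N : X -> {nonneg R} -> R.
Hypothesis FN : is_fuzzy_norm N.

Lemma time_one_scale (l : scalar_field R k) (x : X) :
  l != 0 -> time_one N (l *: x) = N x ((abs_real l)%:num^-1)%:nng.
Proof.
move=> l0; rewrite /time_one (fuzzy_norm_N3 FN)//.
by congr (N x _); apply/val_inj; rewrite /= mul1r.
Qed.

Lemma fuzzy_norm_of_time_one : fuzzy_norm_of (time_one N) = N.
Proof.
apply/funext => x; apply/funext => t; rewrite /fuzzy_norm_of.
have [t0|t0] := eqVneq t%:num 0.
  by rewrite -(fuzzy_norm_N1 FN x); congr (N x _); apply/val_inj; rewrite /= t0.
rewrite /= time_one_scale ?of_real_eq0 ?invr_eq0//.
congr (N x _); apply/val_inj => /=.
by rewrite abs_real_of_real ger0_norm ?invr_ge0// invrK.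
Qed.

(** Homogeneity turns the weight [l] of a point into its time, and the times
    [l] and [1 - l] add up to one. *)
Lemma quasiconcave_time_one : quasiconcave (time_one N).
Proof.
move=> x y l /andP[l0 l1].
have weight z (r : {nonneg R}) :
    0 < r%:num -> N (of_real k r%:num *: z) r = time_one N z.
  move=> r0; rewrite (fuzzy_norm_N3 FN) ?of_real_eq0 ?gt_eqF//.
  congr (N z _); apply/val_inj => /=.
  by rewrite abs_real_of_real gtr0_norm// divff// gt_eqF.
have l1' : 0 < 1 - l by rewrite subr_gt0.
pose t := NngNum (ltW l0); pose s := NngNum (ltW l1').
rewrite -(weight x t)// -(weight y s)//.
apply: le_trans (fuzzy_norm_N4 FN _ _ _ _) _.
rewrite /time_one.
have -> : 1%:nng = (t%:num + s%:num)%:nng :> {nonneg R}; last exact: lexx.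
by apply/val_inj; rewrite /= addrC subrK.
Qed.

Lemma time_one_eq1 (x : X) :
  (forall t : R, time_one N (of_real k t *: x) = 1) -> x = 0.
Proof.
move=> Nx1; apply/(fuzzy_norm_N2 FN) => t t0.
rewrite -fuzzy_norm_of_time_one fuzzy_norm_of_gt0//.
Qed.

Lemma time_one_cvg (x : X) :
  time_one N (of_real k t *: x) @[t --> (0 : R)^'] --> (1 : R).
Proof.
apply: cvg_trans (cvg_comp _ _ cvg_inv_norm_dnbhs0 (fuzzy_norm_N5 FN x)).
apply: near_eq_cvg; apply: filterS (nbhs_dnbhs_neq (0 : R)) => t t0.
rewrite /= time_one_scale ?of_real_eq0//.
by congr (N x _); apply/val_inj; rewrite /= abs_real_of_real.
Qed.

Lemma time_one_abs (l : scalar_field R k) (x : X) :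
  time_one N (l *: x) = time_one N (of_real k (abs_real l)%:num *: x).
Proof.
have [->|l0] := eqVneq l 0; first by rewrite abs_real0 of_real0.
rewrite !time_one_scale ?of_real_eq0 ?abs_real_eq0//.
by congr (N x _); apply/val_inj; rewrite /= abs_real_of_real ger0_norm.
Qed.

Lemma time_one_is_classA : is_classA (time_one N).
Proof.
split.
- by move=> x; exact: (fuzzy_norm_range FN).
- exact: quasiconcave_time_one.
- split; last exact: time_one_eq1.
  exact: (proj2 (fuzzy_norm_N2 FN 0) erefl).
- exact: time_one_cvg.
- exact: time_one_abs.
Qed.

End TimeOne.

Theorem theorem2p1 (R : realType) (k : scalar_kind) (X : lmodType (scalar_field R k)) :
  set_bij (classA X) (fuzzy_norms X) (@fuzzy_norm_of R k X).
Proof.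
split.
- by move=> f; exact: fuzzy_norm_of_is_fuzzy_norm.
- by move=> f g _ _ fg; rewrite -(fuzzy_norm_ofK f) fg fuzzy_norm_ofK.
- move=> N FN; exists (time_one N); first exact: time_one_is_classA.
  exact: fuzzy_norm_of_time_one.
Qed.
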